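(* Let $\mu=(\mu_n)_{n\in\mathbb N}$ be a discrete growth rate. Assume that there is an increasing sequence $(q_n)_{n\in\mathbb N}$ of positive integers with $q_n\ge n+1$ for all $n\in\mathbb N$, and constants $L_1,L_2>1$ such that, for all $n\in\mathbb N$, $$L_1\le\frac{\mu_{q_n}}{\mu_n}\le L_2 .$$ If $T^\mu_Z$ is an invertible operator for some closed subspace $Z\subset X$ and there are constants $\lambda,M>0$ such that $$\|\mathcal A_{m,n}x\|_m\le M(\mu_m/\mu_n)^\lambda\|x\|_n$$ for all $m\ge n$ and $x\in X$, then $(A_m)_{m\in\mathbb N}$ admits a $\mu$-dichotomy with respect to the sequence of norms $(\|\cdot\|_m)_{m\in\mathbb N}$.
   Context: $\mathbb N=\{1,2,\dots\}$. A discrete growth rate is a strictly increasing sequence $(\mu_n)_{n\in\mathbb N}$ of positive real numbers with $\lim_{n\to\infty}\mu_n=+\infty$. Put $\mu_n'=\mu_{n+1}-\mu_n$ and $\phi^\mu_n=\mu_n/\mu_n'$. $(X,\|\cdot\|)$ is a Banach space and $(A_n)_{n\in\mathbb N}$ is a sequence of bounded linear operators on $X$. For $m\ge n$, $\mathcal A_{m,n}=A_{m-1}\cdots A_n$ if $m>n$ and $\mathcal A_{m,n}=\mathrm{Id}$ if $m=n$. $(\|\cdot\|_m)_{m\in\mathbb N}$ is a sequence of norms on $X$ such that each $\|\cdot\|_m$ is equivalent to $\|\cdot\|$. $(A_m)$ admits a $\mu$-dichotomy with respect to $(\|\cdot\|_m)$ if there are projections $P_m$, $m\in\mathbb N$,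 on $X$ such that $A_m|_{\ker P_m}:\ker P_m\to\ker P_{m+1}$ is invertible for all $m$, $P_m\mathcal A_{m,n}=\mathcal A_{m,n}P_n$ for $m\ge n$, and there are constants $\lambda,D>0$ such that for all $x\in X$ and $m,n\in\mathbb N$: $\|\mathcal A_{m,n}P_nx\|_m\le D(\mu_m/\mu_n)^{-\lambda}\|x\|_n$ for $m\ge n$, and $\|\mathcal A_{m,n}Q_nx\|_m\le D(\mu_n/\mu_m)^{-\lambda}\|x\|_n$ for $m\le n$, where $Q_n=\mathrm{Id}-P_n$ and, for $m\le n$, $\mathcal A_{m,n}=(\mathcal A_{n,m})^{-1}:\ker P_n\to\ker P_m$. For a sequence $x=(x_m)_{m\in\mathbb N}$ in $X$ put $\|x\|_\infty=\sup_{m}\|x_m\|_m$; $Y$ is the space of sequences with $\|x\|_\infty<\infty$; for a subspace $Z\subset X$, $Y_Z=\{x\in Y: x_1\in Z\}$, and $Y_0=Y_{\{0\}}$. The linear operator $T^\mu_Z:\mathcal D(T^\mu_Z)\to Y_0$ is given by $(T^\mu_Zx)_1=0$ and $(T^\mu_Zx)_m=\phi^\mu_m(x_m-A_{m-1}x_{m-1})$ for $m\ge2$, with domain $\mathcal D(T^\mu_Z)=\{x\in Y_Z: T^\mu_Zx\in Y_0\}$ endowed with the norm $\|x\|_{T^\mu_Z}=\|x\|_\infty+\|T^\mu_Zx\|_\infty$. $Y_0$ carries $\|\cdot\|_\infty$. Invertible means bijective with bounded inverse. *)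

(* Defs.v *)
From Stdlib Require Import Reals.
From Coquelicot Require Import Coquelicot.
Open Scope R_scope.

(* Index convention: every sequence (x_n), n = 1, 2, ..., is a function on [nat]
   whose value at [k] is the term x_(k+1). *)

(* Coquelicot norms are real-valued over any [AbsRing]; [scalars] selects the
   real or the complex Banach spaces. *)
Inductive field_kind : Set := RealField | ComplexField.

Definition scalars (k : field_kind) : AbsRing :=
  match k with
  | RealField => R_AbsRing
  | ComplexField => C_AbsRing
  end.

Definition of_real (k : field_kind) : R -> scalars k :=
  match k return R -> scalars k with
  | RealField => fun r => r
  | ComplexField => RtoC
  end.

Definition growth_rate (mu : nat -> R) : Prop :=
  (forall n, 0 < mu n) /\
  (forall n, mu n < mu (S n)) /\
  is_lim_seq mu p_infty.

Definition phi (mu : nat -> R) (n : nat) : R := mu n / (mu (S n) - mu n).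

Definition is_norm {K : AbsRing} {X : NormedModule K} (N : X -> R) : Prop :=
  (forall x, 0 <= N x) /\
  (forall x, N x = 0 -> x = zero) /\
  (forall (a : K) x, N (scal a x) = abs a * N x) /\
  (forall x y, N (plus x y) <= N x + N y).

Definition equivalent_to_norm {K : AbsRing} {X : NormedModule K}
    (N : X -> R) : Prop :=
  exists c C : R, 0 < c /\ 0 < C /\
    forall x, c * norm x <= N x /\ N x <= C * norm x.

Definition is_subspace {K : AbsRing} {X : NormedModule K} (Z : X -> Prop) : Prop :=
  Z zero /\
  (forall x y, Z x -> Z y -> Z (plus x y)) /\
  (forall (a : K) x, Z x -> Z (scal a x)).

(* [T] maps [D] bijectively onto [E], and its inverse is bounded from
   [(E, nE)] to [(D, nD)]. *)
Definition invertible_between {U V : Type}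
    (D : U -> Prop) (nD : U -> R) (E : V -> Prop) (nE : V -> R) (T : U -> V) : Prop :=
  (forall x, D x -> E (T x)) /\
  exists S : V -> U,
    (forall y, E y -> D (S y) /\ T (S y) = y) /\
    (forall x, D x -> S (T x) = x) /\
    exists C : R, forall y, E y -> nD (S y) <= C * nE y.

Fixpoint iterate {X : Type} (A : nat -> X -> X) (n j : nat) (x : X) : X :=
  match j with
  | O => x
  | S i => A (n + i)%nat (iterate A n i x)
  end.

(* A_(m-1) ... A_n; only meaningful for n <= m. *)
Definition cocycle {X : Type} (A : nat -> X -> X) (m n : nat) : X -> X :=
  iterate A n (m - n).

Definition is_projection {K : AbsRing} {X : NormedModule K} (P : X -> X) : Prop :=
  is_linear P /\ forall x, P (P x) = P x.

Definition ker {K : AbsRing} {X : NormedModule K} (P : X -> X) (x : X) : Prop :=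
  P x = zero.

(* For m <= n and y in ker P_n, this is the graph of the inverse of
   A_(n,m) : ker P_m -> ker P_n, that is, z = A_(m,n) y. *)
Definition backward {K : AbsRing} {X : NormedModule K} (A P : nat -> X -> X)
    (m n : nat) (y z : X) : Prop :=
  ker (P m) z /\ cocycle A n m z = y.

Definition mu_dichotomy {K : AbsRing} {X : NormedModule K} (mu : nat -> R)
    (A : nat -> X -> X) (N : nat -> X -> R) : Prop :=
  exists P : nat -> X -> X,
    (forall m, is_projection (P m)) /\
    (forall m, invertible_between (ker (P m)) norm (ker (P (S m))) norm (A m)) /\
    (forall m n x, (n <= m)%nat -> P m (cocycle A m n x) = cocycle A m n (P n x)) /\
    exists lambda D : R, 0 < lambda /\ 0 < D /\
      (forall m n x, (n <= m)%nat ->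
         N m (cocycle A m n (P n x)) <= D * Rpower (mu m / mu n) (- lambda) * N n x) /\
      (forall m n x z, (m <= n)%nat ->
         backward A P m n (minus x (P n x)) z ->
         N m z <= D * Rpower (mu n / mu m) (- lambda) * N n x).

Definition sup_norm_bar {X : Type} (N : nat -> X -> R) (x : nat -> X) : Rbar :=
  Sup_seq (fun m => Finite (N m (x m))).

Definition sup_norm {X : Type} (N : nat -> X -> R) (x : nat -> X) : R :=
  real (sup_norm_bar N x).

Definition Y {X : Type} (N : nat -> X -> R) (x : nat -> X) : Prop :=
  Rbar_lt (sup_norm_bar N x) p_infty.

Definition Y_sub {X : Type} (N : nat -> X -> R) (Z : X -> Prop) (x : nat -> X) : Prop :=
  Y N x /\ Z (x O).

Definition Y_zero {K : AbsRing} {X : NormedModule K} (N : nat -> X -> R) :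
    (nat -> X) -> Prop :=
  Y_sub N (fun v => v = zero).

(* The formula for T_Z does not involve Z, which enters through the domain. *)
Definition T_op {k : field_kind} {X : NormedModule (scalars k)} (mu : nat -> R)
    (A : nat -> X -> X) (x : nat -> X) (m : nat) : X :=
  match m with
  | O => zero
  | S j => scal (of_real k (phi mu (S j))) (minus (x (S j)) (A j (x j)))
  end.

Definition T_dom {k : field_kind} {X : NormedModule (scalars k)} (mu : nat -> R)
    (A : nat -> X -> X) (N : nat -> X -> R) (Z : X -> Prop) (x : nat -> X) : Prop :=
  Y_sub N Z x /\ Y_zero N (T_op mu A x).

Definition T_graph_norm {k : field_kind} {X : NormedModule (scalars k)}
    (mu : nat -> R) (A : nat -> X -> X) (N : nat -> X -> R) (x : nat -> X) : R :=
  sup_norm N x + sup_norm N (T_op mu A x).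

Definition T_invertible {k : field_kind} {X : NormedModule (scalars k)}
    (mu : nat -> R) (A : nat -> X -> X) (N : nat -> X -> R) (Z : X -> Prop) : Prop :=
  invertible_between (T_dom mu A N Z) (T_graph_norm mu A N)
    (Y_zero N) (sup_norm N) (T_op mu A).

(* Main.v *)
Require Import Defs.
From Stdlib Require Import Reals Arith Lra Lia IndefiniteDescription.
From Coquelicot Require Import Coquelicot.
Open Scope R_scope.

(** Write [s m] for [log_clock mu m], the sum of [1 / phi mu i] over
    [1 <= i <= m]. It behaves like [ln (mu m)], and in the time [s] a mu-dichotomy
    is an exponential dichotomy. Invertibility of [T_op] means that the equation
    [x (S j) = A j (x j) + f j] has exactly one bounded solution with [x 0] in [Z]
    whenever [f j] is at most [B] times the clock increment [s (S j) - s j], and that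
    this solution is at most [C * B] ([admissible]). Only this property of [T_op]
    is used; a well-chosen test sequence [x] gives each estimate.

    Splitting. The candidate subspaces at time [n] are the vectors with bounded
    forward orbit ([stable]) and the image of [Z] under the cocycle ([unstable]).
    To split [v], one feeds it into the equation little by little, along its own
    orbit, over a window [n < m <= e] of which the clock length is bounded below
    and on which the cocycle grows by at most a constant. Such windows come from
    the sequence [q] and the growth bound. Feeding [v] in at a single time would
    cost a factor [phi mu n], which need not be bounded; spreading it over the
    window costs a constant. The solution [x] is an unstable orbit up to time [n]
    and a stable one after the window, and [v = (v + x n) - x n] is the wanted
    decomposition. The a priori bound on [x] controls both orbits uniformly
    ([splitting]); uniqueness of bounded solutions makes the sum direct
    ([stable_unstable_zero]).

    Decay. For an orbit [u] in either subspace, the sequence [w m * u m], with [w]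
    following the clock between two times, solves the equation with
    forcing of size at most [u] times the clock increment. The a priori bound gives
    a factor of order [1 / (s p - s n)] between the times [n] and [p]
    ([stable_decay], [unstable_decay]). As soon as [mu p / mu n] is larger than a
    fixed constant, this factor is at most 1/2. Since [mu] grows by a bounded
    factor in each step, repeated halving gives a power of [mu p / mu n]
    ([exponential_of_halving]). *)

(** * Differences of vectors *)

Section Minus.

Context {K : AbsRing} {X : NormedModule K}.
Implicit Types x y z : X.

Lemma minus_plus_cancel x y : @plus X (minus x y) y = x.
Proof.
  unfold minus. etransitivity; [symmetry; apply plus_assoc|].
  etransitivity; [apply f_equal; exact (plus_opp_l y) | apply plus_zero_r].
Qed.

Lemma minus_eq_plus x y z : minus x y = z :> X <-> x = plus z y.
Proof.
  split.
  - intros <-. symmetry. apply minus_plus_cancel.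
  - intros ->. unfold minus. etransitivity; [symmetry; apply plus_assoc|].
    etransitivity; [apply f_equal; exact (plus_opp_r y) | apply plus_zero_r].
Qed.

Lemma minus_minus_cancel x y : @minus X x (minus x y) = y :> X.
Proof. apply minus_eq_plus. rewrite plus_comm. symmetry. apply minus_plus_cancel. Qed.

Lemma minus_zero_eq x y : minus x y = @zero X :> X -> x = y.
Proof. intros h%minus_eq_plus. now rewrite plus_zero_l in h. Qed.

Lemma minus_self x : minus x x = @zero X :> X.
Proof. exact (minus_eq_zero x). Qed.

Lemma minus_minus_swap x y z : minus (minus x z) (minus x y) = @minus X y z :> X.
Proof. apply minus_eq_plus. rewrite plus_comm. exact (minus_trans y x z). Qed.

Lemma minus_plus_plus x y z w :
  minus (plus x y) (plus z w) = @plus X (minus x z) (minus y w) :> X.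
Proof.
  apply minus_eq_plus.
  rewrite <- plus_assoc, (plus_comm z w), (@plus_assoc X (minus y w) w z), minus_plus_cancel.
  now rewrite (plus_comm y z), plus_assoc, minus_plus_cancel.
Qed.

Lemma minus_zero x : minus x (@zero X) = x :> X.
Proof. apply minus_eq_plus. now rewrite plus_zero_r. Qed.

Lemma minus_scal (a : K) x y : scal a (minus x y) = @minus X (scal a x) (scal a y) :> X.
Proof.
  symmetry. apply minus_eq_plus. etransitivity; [|exact (scal_distr_l a (minus x y) y)].
  now rewrite minus_plus_cancel.
Qed.

Lemma is_linear_minus (f : X -> X) (hf : is_linear f) x y :
  f (minus x y) = minus (f x) (f y).
Proof. symmetry. apply minus_eq_plus. now rewrite <- (linear_plus f hf), minus_plus_cancel. Qed.

Lemma is_linear_zero (f : X -> X) (hf : is_linear f) : f (@zero X) = @zero X.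
Proof.
  rewrite <- (minus_self (f (@zero X))) at 2. rewrite <- is_linear_minus by assumption.
  now rewrite minus_self.
Qed.

Lemma minus_as_plus x y : minus x y = plus x (scal (opp one) y) :> X.
Proof. unfold minus. apply f_equal. symmetry. exact (scal_opp_one y). Qed.

Lemma is_subspace_minus (Z : X -> Prop) (hZ : is_subspace Z) x y :
  Z x -> Z y -> Z (minus x y).
Proof.
  intros hx hy. rewrite minus_as_plus. apply hZ; [exact hx | now apply hZ].
Qed.

Lemma is_norm_minus (N : X -> R) (hN : is_norm N) x y : N (minus x y) <= N x + N y.
Proof.
  destruct hN as (_ & _ & hs & ht). rewrite minus_as_plus.
  eapply Rle_trans; [apply ht|]. rewrite hs, abs_opp_one. lra.
Qed.

Lemma is_norm_zero (N : X -> R) (hN : is_norm N) : N (@zero X) = 0.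
Proof.
  destruct hN as (_ & _ & hs & _).
  transitivity (N (scal (@zero K) (@zero X))).
  - f_equal. symmetry. exact (scal_zero_l (@zero X)).
  - rewrite hs, abs_zero. ring.
Qed.

End Minus.

(** * Real multiples of vectors *)

Section RealScalars.

Context {k : field_kind} {X : NormedModule (scalars k)}.

Definition rscal (r : R) (v : X) : X := scal (of_real k r) v.

Lemma rscal_plus r s (v : X) : rscal (r + s) v = plus (rscal r v) (rscal s v).
Proof.
  unfold rscal.
  replace (of_real k (r + s)) with (plus (of_real k r) (of_real k s))
    by (destruct k; [reflexivity | symmetry; apply RtoC_plus]).
  exact (@scal_distr_r (scalars k) X (of_real k r) (of_real k s) v).
Qed.

Lemma rscal_mult r s (v : X) : rscal r (rscal s v) = rscal (r * s) v.
Proof.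
  unfold rscal. rewrite scal_assoc. f_equal.
  destruct k; [reflexivity | symmetry; apply RtoC_mult].
Qed.

Lemma rscal_1 (v : X) : rscal 1 v = v.
Proof.
  unfold rscal. replace (of_real k 1) with (one : scalars k) by (destruct k; reflexivity).
  exact (@scal_one (scalars k) X v).
Qed.

Lemma rscal_0 (v : X) : rscal 0 v = @zero X.
Proof.
  unfold rscal. replace (of_real k 0) with (zero : scalars k) by (destruct k; reflexivity).
  exact (@scal_zero_l (scalars k) X v).
Qed.

Lemma rscal_minus r s (v : X) : rscal (r - s) v = minus (rscal r v) (rscal s v).
Proof. symmetry. apply minus_eq_plus. rewrite <- rscal_plus. f_equal. ring. Qed.

Lemma rscal_norm (N : X -> R) (hN : is_norm N) r (v : X) : N (rscal r v) = Rabs r * N v.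
Proof.
  destruct hN as (_ & _ & h & _). unfold rscal. rewrite h. f_equal.
  destruct k; [reflexivity | apply Cmod_R].
Qed.

Lemma is_linear_rscal (f : X -> X) (hf : is_linear f) r v : f (rscal r v) = rscal r (f v).
Proof. apply (linear_scal f hf). Qed.

Lemma is_subspace_rscal (Z : X -> Prop) (hZ : is_subspace Z) r v : Z v -> Z (rscal r v).
Proof. intros h. now apply hZ. Qed.

End RealScalars.

(** * The supremum norm *)

Section SupNorm.

Context {X : Type} (N : nat -> X -> R).

Definition bounded (x : nat -> X) : Prop := exists b, forall m, N m (x m) <= b.

Lemma sup_norm_le x b : (forall m, N m (x m) <= b) -> Y N x /\ sup_norm N x <= b.
Proof.
  intros hb.
  assert (H : Rbar_le (sup_norm_bar N x) b).
  { apply Rbar_not_lt_le. intros [m hm]%Sup_seq_minor_lt. simpl in hm. specialize (hb m). lra. }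
  assert (H0 : Rbar_le (N O (x O)) (sup_norm_bar N x)).
  { apply (Sup_seq_minor_le _ _ O). simpl; lra. }
  unfold Y, sup_norm. destruct (sup_norm_bar N x); simpl in *; try tauto.
Qed.

Lemma le_sup_norm x m : Y N x -> N m (x m) <= sup_norm N x.
Proof.
  intros hY.
  assert (H0 : Rbar_le (N m (x m)) (sup_norm_bar N x)).
  { apply (Sup_seq_minor_le _ _ m). simpl; lra. }
  unfold Y, sup_norm in *. destruct (sup_norm_bar N x); simpl in *; tauto.
Qed.

Lemma Y_bounded x : Y N x <-> bounded x.
Proof.
  split.
  - intros h. exists (sup_norm N x). intros m. now apply le_sup_norm.
  - intros [b hb]. now apply (sup_norm_le x b).
Qed.

Lemma bounded_of_tail x p b : (forall m, (p <= m)%nat -> N m (x m) <= b) -> bounded x.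
Proof.
  revert b. induction p as [|p IH]; intros b hb.
  - exists b. intros m. apply hb. lia.
  - apply (IH (Rmax b (N p (x p)))). intros m hm.
    destruct (Nat.eq_dec m p) as [->|hne].
    + apply Rmax_r.
    + eapply Rle_trans; [apply hb; lia | apply Rmax_l].
Qed.

End SupNorm.

(** * Logarithmic time *)

(** [/ phi mu j] is [mu (S j) / mu j - 1], the increment of [ln mu] to first order;
    the sum starts at index 1 because [T_op] has no equation at index 0. *)
Fixpoint log_clock (mu : nat -> R) (m : nat) : R :=
  match m with
  | O => 0
  | S j => log_clock mu j + / phi mu (S j)
  end.

Section Clock.

Context (mu : nat -> R) (hmu : growth_rate mu).

Lemma growth_rate_mono i j : (i <= j)%nat -> mu i <= mu j.
Proof.
  destruct hmu as (_ & hs & _). induction 1 as [|j _ IH]; [lra|]. specialize (hs j). lra.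
Qed.

Lemma phi_pos n : 0 < phi mu n.
Proof.
  destruct hmu as (hp & hs & _). apply Rdiv_lt_0_compat; [apply hp|]. specialize (hs n). lra.
Qed.

Lemma log_clock_step j : 0 < log_clock mu (S j) - log_clock mu j.
Proof.
  simpl. pose proof (Rinv_0_lt_compat _ (phi_pos (S j))). lra.
Qed.

Lemma log_clock_mono i j : (i <= j)%nat -> log_clock mu i <= log_clock mu j.
Proof.
  induction 1 as [|j _ IH]; [lra|]. pose proof (log_clock_step j). lra.
Qed.

(** Each increment [r - 1], where [r] is a ratio of consecutive terms, is at least
    [ln r]. The index is shifted by one because [phi mu (S j)] involves [mu (S j)]
    and [mu (S (S j))]. *)
Lemma ln_le_log_clock n m : (n <= m)%nat ->
  ln (mu (S m)) - ln (mu (S n)) <= log_clock mu m - log_clock mu n.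
Proof.
  destruct hmu as (hp & hs & _).
  induction 1 as [|m _ IH]; [lra|].
  cut (ln (mu (S (S m))) - ln (mu (S m)) <= / phi mu (S m)); [simpl; lra|].
  pose proof (hp (S m)) as h1. pose proof (hp (S (S m))) as h2. pose proof (hs (S m)) as h3.
  replace (/ phi mu (S m)) with (mu (S (S m)) / mu (S m) - 1)
    by (unfold phi; field; split; lra).
  rewrite <- ln_div by assumption.
  pose proof (exp_ineq1_le (ln (mu (S (S m)) / mu (S m)))) as h.
  rewrite exp_ln in h by (now apply Rdiv_lt_0_compat). lra.
Qed.

(** A weight that is zero up to time [n], runs with the clock from [n] to [p], and
    stays constant afterwards. It switches orbits on and off in the test sequences
    below; it never moves faster than the clock, which keeps the forcing small. *)
Definition ramp (n p m : nat) : R :=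
  log_clock mu (Nat.max n (Nat.min m p)) - log_clock mu n.

Lemma ramp_before n p m : (m <= n)%nat -> ramp n p m = 0.
Proof. intros h. unfold ramp. replace (Nat.max n (Nat.min m p)) with n by lia. ring. Qed.

Lemma ramp_inside n p m : (n <= m <= p)%nat -> ramp n p m = log_clock mu m - log_clock mu n.
Proof. intros h. unfold ramp. now replace (Nat.max n (Nat.min m p)) with m by lia. Qed.

Lemma ramp_after n p m : (n <= p <= m)%nat -> ramp n p m = log_clock mu p - log_clock mu n.
Proof. intros h. unfold ramp. now replace (Nat.max n (Nat.min m p)) with p by lia. Qed.

Lemma ramp_ge0 n p m : 0 <= ramp n p m.
Proof.
  unfold ramp. pose proof (log_clock_mono n (Nat.max n (Nat.min m p)) ltac:(lia)). lra.
Qed.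

Lemma ramp_le n p m : (n <= p)%nat -> ramp n p m <= log_clock mu p - log_clock mu n.
Proof.
  intros h. unfold ramp.
  pose proof (log_clock_mono (Nat.max n (Nat.min m p)) p ltac:(lia)). lra.
Qed.

Lemma ramp_flat n p j : (n <= p)%nat -> ~ (n <= j < p)%nat -> ramp n p (S j) = ramp n p j.
Proof.
  intros h1 h2. unfold ramp.
  now replace (Nat.max n (Nat.min (S j) p)) with (Nat.max n (Nat.min j p)) by lia.
Qed.

Lemma ramp_step n p j : (n <= p)%nat ->
  0 <= ramp n p (S j) - ramp n p j <= log_clock mu (S j) - log_clock mu j.
Proof.
  intros h. pose proof (log_clock_step j) as hs.
  assert (Hc : (n <= j < p \/ ~ (n <= j < p))%nat) by lia.
  destruct Hc as [Hc|Hc].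
  - rewrite !ramp_inside by lia. lra.
  - rewrite ramp_flat by assumption. lra.
Qed.

End Clock.

(** * From repeated halving to exponential decay *)

Lemma half_le_exp a : a <= ln 2 -> / 2 <= exp (- a).
Proof.
  intros h. rewrite exp_Ropp. apply Rinv_le_contravar; [apply exp_pos|].
  rewrite <- (exp_ln 2) by lra. destruct h as [h| ->]; [left; now apply exp_increasing | lra].
Qed.

(** At the first time when [t] has risen by [theta], it has overshot by at most one
    step. *)
Lemma first_passage (t : nat -> R) (theta ell : R) (i j : nat) :
  0 < theta -> (forall n, t (S n) <= t n + ell) -> (i <= j)%nat -> theta <= t j - t i ->
  exists k, (i < k <= j)%nat /\ theta <= t k - t i <= theta + ell.
Proof.
  intros h0 hstep. induction 1 as [|j hij IH]; intros hj; [lra|].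
  destruct (Rle_lt_dec theta (t j - t i)) as [h|h].
  - destruct (IH h) as (k & hk & hk'). exists k. split; [lia | exact hk'].
  - exists (S j). split; [lia|]. specialize (hstep j). lra.
Qed.

(** [G i j c] stands for a contraction by the factor [c] between the times [i] and
    [j]; leaving it abstract serves both the forward estimate on stable orbits and
    the backward one on unstable orbits. Splitting [i, j] at first passages of
    level [theta], each piece gains 1/2 while [t] rises by at most [theta + ell],
    so the rate is [ln 2 / (theta + ell)]; the last incomplete piece costs [2 * B]. *)
Lemma exponential_of_halving (t : nat -> R) (B theta ell : R) :
  0 < B -> 0 < theta -> 0 <= ell -> (forall n, t (S n) <= t n + ell) ->
  exists omega, 0 < omega /\
  forall G : nat -> nat -> R -> Prop,
    (forall i j c d, G i j c -> c <= d -> G i j d) ->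
    (forall i p j c d, (i <= p <= j)%nat -> 0 <= c -> 0 <= d ->
       G i p c -> G p j d -> G i j (c * d)) ->
    (forall i j, (i <= j)%nat -> G i j B) ->
    (forall i j, (i <= j)%nat -> theta <= t j - t i -> G i j (/ 2)) ->
    forall i j, (i <= j)%nat -> G i j (2 * B * exp (- (omega * (t j - t i)))).
Proof.
  intros hB hth hell hstep.
  assert (hln : 0 < ln 2) by (rewrite <- ln_1; apply ln_increasing; lra).
  exists (ln 2 / (theta + ell)).
  assert (hw : 0 < ln 2 / (theta + ell)) by (apply Rdiv_lt_0_compat; lra).
  split; [exact hw|].
  assert (hw' : forall a, a <= theta + ell -> ln 2 / (theta + ell) * a <= ln 2).
  { intros a ha. replace (ln 2) with (ln 2 / (theta + ell) * (theta + ell)) at 2 by (field; lra).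
    apply Rmult_le_compat_l; lra. }
  set (omega := ln 2 / (theta + ell)) in *.
  intros G Gmono Gcomp GB Ghalf i j.
  remember (j - i)%nat as d eqn:Hd. revert i j Hd.
  induction d as [d IH] using lt_wf_ind. intros i j -> hij.
  destruct (Rle_lt_dec theta (t j - t i)) as [h|h].
  - destruct (first_passage t theta ell i j hth hstep hij h) as (p & hp & hp1 & hp2).
    apply (Gmono _ _ (/ 2 * (2 * B * exp (- (omega * (t j - t p)))))).
    + apply (Gcomp _ p); [lia | lra | | apply Ghalf; [lia | lra] |].
      * pose proof (exp_pos (- (omega * (t j - t p)))). nra.
      * apply (IH (j - p)%nat); lia.
    + replace (- (omega * (t j - t i)))
        with (- (omega * (t j - t p)) + - (omega * (t p - t i))) by ring.
      rewrite exp_plus. pose proof (half_le_exp _ (hw' _ hp2)).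
      pose proof (exp_pos (- (omega * (t j - t p)))).
      assert (0 < 2 * B * exp (- (omega * (t j - t p)))) by nra. nra.
  - apply (Gmono _ _ B); [now apply GB|].
    assert (h' : omega * (t j - t i) <= ln 2) by (apply hw'; lra).
    pose proof (half_le_exp _ h'). nra.
Qed.

(** * Orbits *)

Section Cocycle.

Context {X : Type} (A : nat -> X -> X).

Lemma cocycle_refl n x : cocycle A n n x = x.
Proof. unfold cocycle. now rewrite Nat.sub_diag. Qed.

Lemma cocycle_step m n x : (n <= m)%nat -> cocycle A (S m) n x = A m (cocycle A m n x).
Proof.
  intros h. unfold cocycle. rewrite Nat.sub_succ_l by assumption. simpl.
  now replace (n + (m - n))%nat with m by lia.
Qed.

Lemma cocycle_comp m p n x : (n <= p <= m)%nat ->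
  cocycle A m p (cocycle A p n x) = cocycle A m n x.
Proof.
  intros [h1 h2]. induction h2 as [|m h2 IH].
  - apply cocycle_refl.
  - rewrite !cocycle_step by lia. now rewrite IH.
Qed.

End Cocycle.

Section LinearCocycle.

Context {k : field_kind} {X : NormedModule (scalars k)}.
Context (A : nat -> X -> X) (A_lin : forall n, is_linear (A n)).

Lemma cocycle_plus m n (u v : X) :
  cocycle A m n (plus u v) = plus (cocycle A m n u) (cocycle A m n v).
Proof.
  unfold cocycle. induction (m - n)%nat as [|i IH]; simpl; [reflexivity|].
  now rewrite IH, (linear_plus _ (A_lin _)).
Qed.

Lemma cocycle_scal m n (a : scalars k) (v : X) :
  cocycle A m n (scal a v) = scal a (cocycle A m n v).
Proof.
  unfold cocycle. induction (m - n)%nat as [|i IH]; simpl; [reflexivity|].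
  now rewrite IH, (linear_scal _ (A_lin _)).
Qed.

Lemma cocycle_zero m n : cocycle A m n (@zero X) = @zero X.
Proof.
  unfold cocycle. induction (m - n)%nat as [|i IH]; simpl; [reflexivity|].
  now rewrite IH, is_linear_zero.
Qed.

Lemma cocycle_minus m n (u v : X) :
  cocycle A m n (minus u v) = minus (cocycle A m n u) (cocycle A m n v).
Proof. symmetry. apply minus_eq_plus. now rewrite <- cocycle_plus, minus_plus_cancel. Qed.

End LinearCocycle.

(** * The inhomogeneous equation *)

Section Admissibility.

Context {k : field_kind} {X : NormedModule (scalars k)}.
Context (mu : nat -> R) (A : nat -> X -> X) (N : nat -> X -> R) (Z : X -> Prop).

Definition defect (x : nat -> X) (j : nat) : X := minus (x (S j)) (A j (x j)).

(** The term [f j] acts on the step from [j] to [S j]. The clock increment there is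
    [/ phi mu (S j)], so this bound says that the right-hand side of
    [T_op mu A x = y] is at most [B]. *)
Definition clock_bounded (f : nat -> X) (B : R) : Prop :=
  forall j, N (S j) (f j) <= B * (log_clock mu (S j) - log_clock mu j).

(** Existence in the first half, uniqueness with an a priori bound in the second:
    the invertibility of [T_op] with the factors [phi] absorbed in the clock. *)
Definition admissible (C : R) : Prop :=
  (forall f B, clock_bounded f B ->
     exists x, bounded N x /\ Z (x O) /\ forall j, defect x j = f j) /\
  (forall x B, bounded N x -> Z (x O) -> clock_bounded (defect x) B ->
     forall m, N m (x m) <= C * B).

Lemma clock_bounded_ge0 (hmu : growth_rate mu) (hN : forall n, is_norm (N n)) f B :
  clock_bounded f B -> 0 <= B.
Proof.
  intros h. specialize (h O). destruct (hN 1%nat) as (h0 & _). specialize (h0 (f O)).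
  pose proof (log_clock_step mu hmu O) as h1.
  destruct (Rle_lt_dec 0 B) as [|hB]; [assumption|]. nra.
Qed.

Lemma admissible_of_T_invertible (hmu : growth_rate mu) (hN : forall n, is_norm (N n)) :
  T_invertible mu A N Z -> exists C, 0 < C /\ admissible C.
Proof.
  intros (_ & Sol & hSol1 & hSol2 & C & hC).
  assert (hphi : forall j v B, N (S j) v <= B * (log_clock mu (S j) - log_clock mu j) ->
                 N (S j) (rscal (phi mu (S j)) v) <= B).
  { intros j v B h. rewrite rscal_norm by apply hN.
    pose proof (phi_pos mu hmu (S j)) as hp. rewrite Rabs_pos_eq by lra.
    simpl in h.
    replace B with (phi mu (S j) * (B * (log_clock mu j + / phi mu (S j) - log_clock mu j)))
      by (field; lra).
    apply Rmult_le_compat_l; [lra | exact h]. }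
  exists (Rmax C 1). split; [pose proof (Rmax_r C 1); lra|]. split.
  - intros f B hf. pose proof (clock_bounded_ge0 hmu hN f B hf) as hB.
    pose (y := fun m => match m with O => zero | S j => rscal (phi mu (S j)) (f j) end).
    assert (hy : Y_zero N y).
    { split; [|reflexivity]. apply (sup_norm_le N y B). intros [|j]; simpl.
      - now rewrite is_norm_zero.
      - now apply hphi. }
    destruct (hSol1 y hy) as (((hY & hZ) & _) & hT).
    exists (Sol y). split; [now apply Y_bounded|]. split; [exact hZ|]. intros j.
    pose proof (f_equal (fun z => rscal (/ phi mu (S j)) (z (S j))) hT) as h.
    cbv beta in h. unfold y in h at 2. unfold T_op in h.
    change (rscal (/ phi mu (S j)) (rscal (phi mu (S j)) (defect (Sol y) j))
      = rscal (/ phi mu (S j)) (rscal (phi mu (S j)) (f j))) in h.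
    pose proof (phi_pos mu hmu (S j)) as hp.
    rewrite !rscal_mult, Rinv_l, !rscal_1 in h by lra. exact h.
  - intros x B hb hx hd m. pose proof (clock_bounded_ge0 hmu hN _ B hd) as hB.
    destruct (sup_norm_le N (T_op mu A x) B) as (hTY & hTB).
    { intros [|j]; simpl.
      - now rewrite is_norm_zero.
      - apply hphi. apply hd. }
    assert (hY : Y N x) by now apply Y_bounded.
    assert (hT0 : Y_zero N (T_op mu A x)) by (split; [exact hTY | reflexivity]).
    specialize (hC _ hT0). rewrite hSol2 in hC by (repeat split; assumption).
    unfold T_graph_norm in hC.
    pose proof (le_sup_norm N x m hY) as h1.
    assert (h2 : 0 <= sup_norm N (T_op mu A x)).
    { eapply Rle_trans; [|apply (le_sup_norm N _ O hTY)]. apply hN. }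
    pose proof (Rmax_l C 1). pose proof (Rmax_r C 1).
    set (s := sup_norm N (T_op mu A x)) in *.
    assert (C * s <= Rmax C 1 * s) by (apply Rmult_le_compat_r; assumption).
    assert (Rmax C 1 * s <= Rmax C 1 * B) by (apply Rmult_le_compat_l; lra). lra.
Qed.

End Admissibility.

(** * The splitting and its bounds *)

Section Dichotomy.

Context {k : field_kind} {X : NormedModule (scalars k)}.
Context (mu : nat -> R) (A : nat -> X -> X) (N : nat -> X -> R) (Z : X -> Prop).
Context (hmu : growth_rate mu) (A_lin : forall n, is_linear (A n)).
Context (N_norm : forall n, is_norm (N n)) (Z_sub : is_subspace Z).
Context (C : R) (C_pos : 0 < C) (adm : admissible mu A N Z C).

Let N_ge0 n v : 0 <= N n v. Proof. apply N_norm. Qed.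
Let N_rscal n r v : N n (rscal r v) = Rabs r * N n v. Proof. now apply rscal_norm. Qed.
Let N_def n v : N n v = 0 -> v = @zero X. Proof. apply N_norm. Qed.

(** By the product rule, only the increments of the weight of a true orbit enter
    the forcing. *)
Lemma defect_weighted (w : nat -> R) (u : nat -> X) j :
  u (S j) = A j (u j) ->
  defect A (fun m => rscal (w m) (u m)) j = rscal (w (S j) - w j) (u (S j)).
Proof. intros h. unfold defect. now rewrite is_linear_rscal, <- h, <- rscal_minus. Qed.

(** Such an orbit solves the homogeneous equation, so it vanishes by uniqueness. *)
Lemma bounded_unstable_orbit_zero n b z :
  Z z -> (forall m, (n <= m)%nat -> N m (cocycle A m O z) <= b) ->
  forall m, cocycle A m O z = @zero X.
Proof.
  intros hz hb m. apply (N_def m). apply Rle_antisym; [|apply N_ge0].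
  rewrite <- (Rmult_0_r C).
  apply (proj2 adm (fun m => cocycle A m O z)).
  - now apply bounded_of_tail with n b.
  - now rewrite cocycle_refl.
  - intros j. unfold defect. rewrite cocycle_step by lia. rewrite minus_self.
    rewrite is_norm_zero by apply N_norm. lra.
Qed.

Context (delta K : R) (delta_pos : 0 < delta) (K_pos : 0 < K).
(* The clock length of the window bounds the forcing from above, the growth of the
   cocycle on it bounds the orbit that is fed in. *)
Context (window : forall n, exists e, (n < e)%nat /\
  delta <= log_clock mu e - log_clock mu n /\
  forall m v, (n <= m <= e)%nat -> N m (cocycle A m n v) <= K * N n v).

(** The solution that splits [v] is at most [C * (K / delta)] times [v]; the other
    term [K] pays for the part of [v] not yet fed in during the window. *)
Definition split_bound : R := C * (K / delta) + K.

Lemma split_bound_pos : 0 < split_bound.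
Proof.
  unfold split_bound. assert (0 < K / delta) by now apply Rdiv_lt_0_compat. nra.
Qed.

(** The forcing feeds [v] in along its orbit over the window, the fraction [theta m]
    having arrived by time [m]. The minus sign in [z] comes from
    [v = (v + x n) - x n]: the unstable part of [v] is [- x n]. *)
Lemma splitting n v : exists z, Z z /\
  (forall m, (m <= n)%nat -> N m (cocycle A m O z) <= split_bound * N n v) /\
  (forall m, (n <= m)%nat ->
     N m (cocycle A m n (minus v (cocycle A n O z))) <= split_bound * N n v).
Proof.
  destruct (window n) as (e & hne & hdel & hK).
  set (sigma := log_clock mu e - log_clock mu n) in *.
  set (theta := fun m => ramp mu n e m / sigma).
  set (f := fun j => rscal (theta (S j) - theta j) (cocycle A (S j) n v)).
  set (B := K / delta * N n v).
  assert (hKd : 0 < K / delta) by now apply Rdiv_lt_0_compat.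
  assert (hf : clock_bounded mu N f B).
  { intros j. unfold f. rewrite N_rscal. pose proof (log_clock_step mu hmu j) as hs.
    assert (Hc : (n <= j < e \/ ~ (n <= j < e))%nat) by lia.
    destruct Hc as [Hc|Hc].
    - pose proof (ramp_step mu hmu n e j ltac:(lia)) as hr.
      set (d := log_clock mu (S j) - log_clock mu j) in *.
      replace (theta (S j) - theta j) with ((ramp mu n e (S j) - ramp mu n e j) / sigma)
        by (unfold theta; field; lra).
      assert (h1 : 0 <= (ramp mu n e (S j) - ramp mu n e j) / sigma <= d / delta).
      { split; [apply Rle_mult_inv_pos; lra|]. unfold Rdiv.
        apply Rmult_le_compat; [lra | left; apply Rinv_0_lt_compat; lra | lra |].
        apply Rinv_le_contravar; lra. }
      rewrite Rabs_pos_eq by lra.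
      replace (B * d) with (d / delta * (K * N n v)) by (unfold B; field; lra).
      apply Rmult_le_compat; [lra | apply N_ge0 | lra | apply hK; lia].
    - unfold theta. rewrite ramp_flat by (lia || assumption).
      rewrite Rminus_diag, Rabs_R0, Rmult_0_l.
      apply Rmult_le_pos; [|lra]. apply Rmult_le_pos; [lra | apply N_ge0]. }
  destruct (proj1 adm f B hf) as (x & hxb & hx0 & hx).
  assert (hxB : forall m, N m (x m) <= C * B).
  { apply (proj2 adm x B hxb hx0). intros j. rewrite hx. apply hf. }
  assert (hxS : forall j, x (S j) = plus (f j) (A j (x j))).
  { intros j. apply minus_eq_plus. apply hx. }
  (* no forcing has arrived up to time n, so x is an orbit starting in Z *)
  assert (hpast : forall m, (m <= n)%nat -> x m = cocycle A m O (x O)).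
  { induction m as [|m IH]; intros hm; [now rewrite cocycle_refl|].
    rewrite hxS, cocycle_step, <- IH by lia. unfold f, theta.
    rewrite !ramp_before by lia. rewrite Rminus_diag, rscal_0. apply plus_zero_l. }
  assert (hfut : forall m, (n <= m)%nat ->
    x m = plus (rscal (theta m) (cocycle A m n v)) (cocycle A m n (x n))).
  { induction 1 as [|m hm IH].
    - unfold theta. rewrite ramp_before by lia. unfold Rdiv.
      now rewrite Rmult_0_l, rscal_0, plus_zero_l, cocycle_refl.
    - rewrite hxS, IH, (linear_plus _ (A_lin m)), is_linear_rscal by apply A_lin.
      unfold f. rewrite <- !cocycle_step by assumption.
      rewrite plus_assoc, <- rscal_plus. do 2 f_equal. ring. }
  set (z := rscal (-1) (x O)).
  assert (hz : forall m, cocycle A m O z = rscal (-1) (cocycle A m O (x O))).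
  { intros m. unfold z, rscal. now apply cocycle_scal. }
  exists z. split; [now apply is_subspace_rscal|].
  assert (hCB : 0 <= C * B <= split_bound * N n v).
  { pose proof (N_ge0 n v). unfold B, split_bound. split; [|nra].
    apply Rmult_le_pos; [lra|]. apply Rmult_le_pos; lra. }
  split.
  - intros m hm. rewrite hz, N_rscal, <- hpast by assumption.
    replace (Rabs (-1)) with 1 by (rewrite Rabs_left; lra). specialize (hxB m). lra.
  - intros m hm.
    (* the orbit of v + x n is x plus the fraction of v still to arrive *)
    assert (hs : cocycle A m n (minus v (cocycle A n O z))
                 = plus (rscal (1 - theta m) (cocycle A m n v)) (x m)).
    { rewrite cocycle_minus by assumption. apply minus_eq_plus.
      rewrite (hfut m hm), hz, <- hpast by lia.
      unfold rscal at 3. rewrite cocycle_scal by assumption.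
      fold (rscal (k := k) (-1) (cocycle A m n (x n))).
      rewrite <- !plus_assoc.
      rewrite <- (rscal_1 (cocycle A m n (x n))) at 1. rewrite <- rscal_plus.
      replace (1 + -1) with 0 by ring. rewrite rscal_0, plus_zero_r, <- rscal_plus.
      replace (1 - theta m + theta m) with 1 by ring. now rewrite rscal_1. }
    rewrite hs. destruct (N_norm m) as (_ & _ & _ & htri).
    eapply Rle_trans; [apply htri|]. rewrite N_rscal.
    assert (hth : 0 <= theta m <= 1).
    { pose proof (ramp_ge0 mu hmu n e m). pose proof (ramp_le mu hmu n e m ltac:(lia)).
      unfold theta. split; [apply Rle_mult_inv_pos; lra|].
      apply Rmult_le_reg_r with sigma; [lra|]. unfold Rdiv.
      rewrite Rmult_assoc, Rinv_l by lra. unfold sigma. lra. }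
    assert (hw : Rabs (1 - theta m) * N m (cocycle A m n v) <= K * N n v).
    { destruct (Nat.le_gt_cases m e) as [hme|hme].
      - rewrite Rabs_pos_eq by lra. specialize (hK m v ltac:(lia)).
        pose proof (N_ge0 m (cocycle A m n v)). nra.
      - unfold theta. rewrite ramp_after by lia. fold sigma.
        unfold Rdiv. rewrite Rinv_r, Rminus_diag, Rabs_R0, Rmult_0_l by lra.
        apply Rmult_le_pos; [lra | apply N_ge0]. }
    specialize (hxB m). unfold split_bound. unfold B in hxB. lra.
Qed.

(** * Stable and unstable vectors *)

Definition stable (n : nat) (v : X) : Prop :=
  exists b, forall m, (n <= m)%nat -> N m (cocycle A m n v) <= b.

Definition unstable (n : nat) (v : X) : Prop := exists z, Z z /\ v = cocycle A n O z.

Lemma stable_minus n u v : stable n u -> stable n v -> stable n (minus u v).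
Proof.
  intros (b & hb) (c & hc). exists (b + c). intros m hm.
  rewrite cocycle_minus by assumption.
  eapply Rle_trans; [apply is_norm_minus, N_norm|].
  specialize (hb m hm). specialize (hc m hm). lra.
Qed.

Lemma stable_unstable_zero n z m :
  Z z -> stable n (cocycle A n O z) -> cocycle A m O z = @zero X.
Proof.
  intros hz (b & hb). apply (bounded_unstable_orbit_zero n b); [exact hz|].
  intros p hp. rewrite <- (cocycle_comp A p n O) by lia. now apply hb.
Qed.

(** The unstable part of a stable vector is zero, so the bound of [splitting]
    applies to the vector itself. *)
Lemma stable_bound n m v : stable n v -> (n <= m)%nat ->
  N m (cocycle A m n v) <= split_bound * N n v.
Proof.
  intros hv hm. destruct (splitting n v) as (z & hz & _ & hs).
  assert (h : cocycle A n O z = @zero X).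
  { apply (stable_unstable_zero n); [exact hz|].
    rewrite <- (minus_minus_cancel v). apply stable_minus; [exact hv|].
    exists (split_bound * N n v). exact hs. }
  specialize (hs m hm). rewrite h in hs.
  now rewrite minus_zero in hs.
Qed.

(** [splitting] applied to the vector at time [n] returns the same unstable orbit,
    because the difference of the two is stable at [n]. *)
Lemma unstable_bound n m z : Z z -> (m <= n)%nat ->
  N m (cocycle A m O z) <= split_bound * N n (cocycle A n O z).
Proof.
  intros hz hm. destruct (splitting n (cocycle A n O z)) as (z' & hz' & hu & hs).
  rewrite (minus_zero_eq (cocycle A m O z) (cocycle A m O z')); [now apply hu|].
  rewrite <- cocycle_minus by assumption. apply (stable_unstable_zero n).
  - now apply is_subspace_minus.
  - rewrite cocycle_minus by assumption. eexists. exact hs.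
Qed.

(** * Decay in logarithmic time *)

(** Test sequence: the orbit of [v] multiplied by a weight that rises with the clock
    from 0 at time [n] to [s p - s n] at time [p], then stays constant. *)
Lemma stable_decay n p v : stable n v -> (n <= p)%nat ->
  (log_clock mu p - log_clock mu n) * N p (cocycle A p n v)
    <= C * split_bound * N n v.
Proof.
  intros hv hp.
  set (u := fun m => cocycle A m n v).
  set (x := fun m => rscal (ramp mu n p m) (u m)).
  assert (hd : forall j, defect A x j
    = rscal (ramp mu n p (S j) - ramp mu n p j) (u (S j))).
  { intros j. destruct (Nat.le_gt_cases n j) as [hj|hj].
    - apply defect_weighted. now apply cocycle_step.
    - unfold defect, x. rewrite !ramp_before by lia.
      rewrite Rminus_diag, !rscal_0, is_linear_zero by apply A_lin. apply minus_self. }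
  pose proof split_bound_pos as hsb.
  assert (hx : forall m, N m (x m) <= C * (split_bound * N n v)).
  { apply (proj2 adm).
    - apply (bounded_of_tail N x p ((log_clock mu p - log_clock mu n) * (split_bound * N n v))).
      intros m hm. unfold x. rewrite N_rscal, ramp_after by lia.
      pose proof (log_clock_mono mu hmu n p hp). rewrite Rabs_pos_eq by lra.
      apply Rmult_le_compat_l; [lra|]. apply stable_bound; [exact hv | lia].
    - unfold x. rewrite ramp_before, rscal_0 by lia. apply Z_sub.
    - intros j. rewrite hd, N_rscal. pose proof (ramp_step mu hmu n p j hp).
      rewrite Rabs_pos_eq, Rmult_comm by lra.
      pose proof (N_ge0 n v).
      destruct (Nat.le_gt_cases n j) as [hj|hj].
      + apply Rmult_le_compat; [apply N_ge0 | lra | | lra].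
        apply stable_bound; [exact hv | lia].
      + rewrite !ramp_before by lia. rewrite Rminus_diag, Rmult_0_r.
        apply Rmult_le_pos; [|lra]. apply Rmult_le_pos; lra. }
  specialize (hx p). unfold x in hx. rewrite N_rscal, ramp_after in hx by lia.
  pose proof (log_clock_mono mu hmu n p hp). rewrite Rabs_pos_eq in hx by lra.
  unfold u in hx. lra.
Qed.

(** Test sequence: the orbit of [z] multiplied by a weight that rises with the clock
    from [s 0 - s n] at time 0 to 0 at time [n] and vanishes afterwards; it is
    bounded although the orbit may not be. *)
Lemma unstable_decay m n z : Z z -> (m <= n)%nat ->
  (log_clock mu n - log_clock mu m) * N m (cocycle A m O z)
    <= C * split_bound * N n (cocycle A n O z).
Proof.
  intros hz hm.
  set (u := fun m => cocycle A m O z).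
  set (w := fun m => ramp mu O n m - (log_clock mu n - log_clock mu O)).
  set (x := fun m => rscal (w m) (u m)).
  pose proof split_bound_pos as hsb. pose proof (N_ge0 n (u n)) as hun.
  assert (hx : forall m, N m (x m) <= C * (split_bound * N n (u n))).
  { apply (proj2 adm).
    - apply (bounded_of_tail N x n 0). intros p hp. unfold x, w.
      rewrite ramp_after, Rminus_diag, rscal_0, is_norm_zero by (lia || apply N_norm). lra.
    - unfold x, u. rewrite cocycle_refl. now apply is_subspace_rscal.
    - intros j. unfold x. rewrite defect_weighted by (apply cocycle_step; lia).
      rewrite N_rscal. replace (w (S j) - w j) with (ramp mu O n (S j) - ramp mu O n j)
        by (unfold w; ring).
      pose proof (ramp_step mu hmu O n j ltac:(lia)).
      rewrite Rabs_pos_eq, Rmult_comm by lra.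
      destruct (Nat.le_gt_cases (S j) n) as [hj|hj].
      + apply Rmult_le_compat; [apply N_ge0 | lra | | lra]. now apply unstable_bound.
      + rewrite ramp_flat by lia. rewrite Rminus_diag, Rmult_0_r.
        apply Rmult_le_pos; [|lra]. apply Rmult_le_pos; lra. }
  specialize (hx m). unfold x, w in hx. rewrite N_rscal, ramp_inside in hx by lia.
  pose proof (log_clock_mono mu hmu m n hm). rewrite Rabs_left1 in hx by lra.
  unfold u in hx. lra.
Qed.

(** * Exponential bounds *)

Context (L : R) (L_gt1 : 1 < L) (mu_jump : forall n, mu (S n) <= L * mu n).

Lemma ln_mu_jump n : ln (mu (S n)) <= ln (mu n) + ln L.
Proof.
  pose proof (proj1 hmu n). pose proof (proj1 hmu (S n)).
  rewrite Rplus_comm, <- ln_mult by lra.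
  destruct (mu_jump n) as [h|h]; [left; now apply ln_increasing | rewrite h; lra].
Qed.

Lemma ln_L_pos : 0 < ln L.
Proof. rewrite <- ln_1. apply ln_increasing; lra. Qed.

Lemma log_clock_gap i j : (i <= j)%nat ->
  ln (mu j) - ln (mu i) - ln L <= log_clock mu j - log_clock mu i.
Proof.
  intros h. pose proof (ln_le_log_clock mu hmu i j h). pose proof (ln_mu_jump i).
  destruct hmu as (hp & hs & _). pose proof (ln_increasing _ _ (hp j) (hs j)). lra.
Qed.

(** The threshold makes the elapsed clock time at least [2 * (C * split_bound)], the
    term [ln L] covering the index shift in [log_clock_gap]. *)
Lemma half_of_gap i j a b : (i <= j)%nat ->
  ln L + 2 * (C * split_bound) <= ln (mu j) - ln (mu i) -> 0 <= a ->
  (log_clock mu j - log_clock mu i) * a <= C * split_bound * b -> a <= / 2 * b.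
Proof.
  intros hij hgap ha h. pose proof (log_clock_gap i j hij).
  pose proof split_bound_pos.
  assert (hcs : 0 < C * split_bound) by now apply Rmult_lt_0_compat.
  assert (h2 : 2 * (C * split_bound) * a <= (log_clock mu j - log_clock mu i) * a)
    by (apply Rmult_le_compat_r; lra).
  apply Rmult_le_reg_l with (2 * (C * split_bound)); lra.
Qed.

Lemma Rpower_ratio i j omega :
  Rpower (mu j / mu i) (- omega) = exp (- (omega * (ln (mu j) - ln (mu i)))).
Proof.
  unfold Rpower. rewrite ln_div by apply hmu. f_equal. ring.
Qed.

Lemma exponential_bounds : exists omega D, 0 < omega /\ 0 < D /\
  (forall m n v, (n <= m)%nat -> stable n v ->
     N m (cocycle A m n v) <= D * Rpower (mu m / mu n) (- omega) * N n v) /\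
  (forall m n z, (m <= n)%nat -> Z z ->
     N m (cocycle A m O z) <= D * Rpower (mu n / mu m) (- omega) * N n (cocycle A n O z)).
Proof.
  pose proof split_bound_pos as hB. pose proof ln_L_pos as hL.
  assert (hCB : 0 < C * split_bound) by now apply Rmult_lt_0_compat.
  destruct (exponential_of_halving (fun n => ln (mu n)) split_bound
    (ln L + 2 * (C * split_bound)) (ln L) hB ltac:(lra) ltac:(lra) ln_mu_jump)
    as (omega & homega & hG).
  exists omega, (2 * split_bound). split; [exact homega|]. split; [lra|]. split.
  - intros m n v hnm hv. rewrite Rpower_ratio. revert n m hnm v hv.
    apply (hG (fun i j c => forall v, stable i v -> N j (cocycle A j i v) <= c * N i v)).
    + intros i j c d h hcd v hv. specialize (h v hv). pose proof (N_ge0 i v). nra.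
    + intros i p j c d hp hc hd h1 h2 v hv.
      rewrite <- (cocycle_comp A j p i) by lia.
      eapply Rle_trans; [apply h2|].
      * destruct hv as (b & hb). exists b. intros q hq.
        rewrite cocycle_comp by lia. apply hb. lia.
      * specialize (h1 v hv). rewrite (Rmult_comm c), Rmult_assoc.
        now apply Rmult_le_compat_l.
    + intros i j hij v hv. now apply stable_bound.
    + intros i j hij hgap v hv. apply (half_of_gap i j); try assumption; [apply N_ge0|].
      now apply stable_decay.
  - intros m n z hmn hz. rewrite Rpower_ratio. revert m n hmn z hz.
    apply (hG (fun i j c => forall z, Z z ->
      N i (cocycle A i O z) <= c * N j (cocycle A j O z))).
    + intros i j c d h hcd z hz. specialize (h z hz).
      pose proof (N_ge0 j (cocycle A j O z)). nra.
    + intros i p j c d hp hc hd h1 h2 z hz.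
      eapply Rle_trans; [now apply h1|]. rewrite Rmult_assoc.
      apply Rmult_le_compat_l; [exact hc | now apply h2].
    + intros i j hij z hz. now apply unstable_bound.
    + intros i j hij hgap z hz. apply (half_of_gap i j); try assumption; [apply N_ge0|].
      now apply unstable_decay.
Qed.

(** * Projections *)

Lemma splitting_unique n v p p' :
  stable n p -> unstable n (minus v p) -> stable n p' -> unstable n (minus v p') -> p = p'.
Proof.
  intros hp (z & hz & ez) hp' (z' & hz' & ez'). apply minus_zero_eq.
  assert (e : minus p p' = cocycle A n O (minus z' z)).
  { now rewrite cocycle_minus, <- ez, <- ez', minus_minus_swap by assumption. }
  rewrite e. apply (stable_unstable_zero n); [now apply is_subspace_minus|].
  rewrite <- e. now apply stable_minus.
Qed.

Lemma stable_zero n : stable n (@zero X).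
Proof.
  exists 0. intros m _. rewrite cocycle_zero, is_norm_zero by (assumption || apply N_norm). lra.
Qed.

Lemma stable_plus n u v : stable n u -> stable n v -> stable n (plus u v).
Proof.
  intros (b & hb) (c & hc). exists (b + c). intros m hm.
  rewrite cocycle_plus by assumption. destruct (N_norm m) as (_ & _ & _ & htri).
  eapply Rle_trans; [apply htri|]. specialize (hb m hm). specialize (hc m hm). lra.
Qed.

Lemma stable_scal n (a : scalars k) v : stable n v -> stable n (scal a v).
Proof.
  intros (b & hb). exists (abs a * b). intros m hm.
  rewrite cocycle_scal by assumption. destruct (N_norm m) as (_ & _ & hs & _).
  rewrite hs. apply Rmult_le_compat_l; [apply abs_ge_0 | now apply hb].
Qed.

Lemma stable_forward n m v : (n <= m)%nat -> stable n v -> stable m (cocycle A m n v).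
Proof.
  intros hm (b & hb). exists b. intros p hp. rewrite cocycle_comp by lia. apply hb. lia.
Qed.

Lemma unstable_zero n : unstable n (@zero X).
Proof.
  exists (@zero X). split; [apply Z_sub | now rewrite cocycle_zero].
Qed.

Lemma unstable_plus n u v : unstable n u -> unstable n v -> unstable n (plus u v).
Proof.
  intros (z & hz & ->) (w & hw & ->). exists (plus z w).
  split; [now apply Z_sub | now rewrite cocycle_plus].
Qed.

Lemma unstable_minus n u v : unstable n u -> unstable n v -> unstable n (minus u v).
Proof.
  intros (z & hz & ->) (w & hw & ->). exists (minus z w).
  split; [now apply is_subspace_minus | now rewrite cocycle_minus].
Qed.

Lemma unstable_scal n (a : scalars k) v : unstable n v -> unstable n (scal a v).
Proof.
  intros (z & hz & ->). exists (scal a z).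
  split; [now apply Z_sub | now rewrite cocycle_scal].
Qed.

Lemma unstable_forward n m v : (n <= m)%nat -> unstable n v -> unstable m (cocycle A m n v).
Proof.
  intros hm (z & hz & ->). exists z. split; [exact hz|]. apply cocycle_comp. lia.
Qed.

Lemma unstable_bound_one_step m v : unstable m v -> N m v <= split_bound * N (S m) (A m v).
Proof.
  intros (z & hz & ->). rewrite <- cocycle_step by lia. apply unstable_bound; [exact hz | lia].
Qed.

Lemma unstable_preimage m y : unstable (S m) y -> exists v, unstable m v /\ A m v = y.
Proof.
  intros (z & hz & ->). exists (cocycle A m O z). split; [now exists z|].
  symmetry. apply cocycle_step. lia.
Qed.

Lemma dichotomy_projection : exists P : nat -> X -> X, forall n v,
  stable n (P n v) /\ unstable n (minus v (P n v)) /\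
  N n (P n v) <= split_bound * N n v /\ N n (minus v (P n v)) <= split_bound * N n v.
Proof.
  destruct (functional_choice (fun (nv : nat * X) p =>
    stable (fst nv) p /\ unstable (fst nv) (minus (snd nv) p) /\
    N (fst nv) p <= split_bound * N (fst nv) (snd nv) /\
    N (fst nv) (minus (snd nv) p) <= split_bound * N (fst nv) (snd nv))) as (P & hP).
  - intros (n & v). simpl. destruct (splitting n v) as (z & hz & hu & hs).
    exists (minus v (cocycle A n O z)). rewrite minus_minus_cancel. repeat split.
    + eexists. exact hs.
    + now exists z.
    + specialize (hs n (Nat.le_refl n)). now rewrite cocycle_refl in hs.
    + apply hu. lia.
  - exists (fun n v => P (n, v)). intros n v. apply (hP (n, v)).
Qed.

Context (N_equiv : forall n, equivalent_to_norm (N n)).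

(** [A m] is onto by the very definition of the unstable spaces; the one-step
    backward bound gives both injectivity and the bound on the inverse. *)
Lemma unstable_isomorphism m (D E : X -> Prop) :
  (forall v, D v <-> unstable m v) -> (forall v, E v <-> unstable (S m) v) ->
  invertible_between D norm E norm (A m).
Proof.
  intros hD hE. split.
  - intros v hv. apply hE. apply hD in hv.
    rewrite <- (cocycle_refl A m v), <- cocycle_step by lia.
    apply unstable_forward; [lia | exact hv].
  - destruct (functional_choice (fun y v => unstable (S m) y -> unstable m v /\ A m v = y))
      as (Sol & hSol).
    { intros y. destruct (Classical_Prop.classic (unstable (S m) y)) as [hy|hy].
      - destruct (unstable_preimage m y hy) as (v & hv). now exists v.
      - exists y. contradiction. }
    exists Sol. repeat split.
    + apply hD. now apply hSol, hE.
    + now apply hSol, hE.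
    + intros v hv. apply hD in hv.
      assert (hAv : unstable (S m) (A m v)).
      { rewrite <- (cocycle_refl A m v), <- cocycle_step by lia.
        apply unstable_forward; [lia | exact hv]. }
      destruct (hSol _ hAv) as (h1 & h2). apply minus_zero_eq. apply (N_def m).
      apply Rle_antisym; [|apply N_ge0].
      eapply Rle_trans; [apply unstable_bound_one_step; now apply unstable_minus|].
      rewrite is_linear_minus, h2, minus_self, is_norm_zero by (apply A_lin || apply N_norm).
      lra.
    + destruct (N_equiv m) as (c & c0 & hc & _ & hc').
      destruct (N_equiv (S m)) as (c2 & c1 & _ & hc1 & hc1').
      exists (split_bound * c1 / c). intros y hy. apply hE in hy.
      destruct (hSol y hy) as (h1 & h2). apply unstable_bound_one_step in h1.
      rewrite h2 in h1. pose proof (proj1 (hc' (Sol y))) as h3.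
      pose proof (proj2 (hc1' y)) as h4. pose proof split_bound_pos as h5.
      apply Rmult_le_reg_l with c; [exact hc|].
      replace (c * (split_bound * c1 / c * norm y)) with (split_bound * (c1 * norm y))
        by (field; lra).
      apply Rle_trans with (split_bound * N (S m) y); [lra|].
      apply Rmult_le_compat_l; lra.
Qed.

(** All algebraic properties of the projections (linearity, idempotence, invariance)
    follow from uniqueness of the splitting [hPu], since both families of subspaces
    are linear and invariant. *)
Lemma mu_dichotomy_of_admissible : mu_dichotomy mu A N.
Proof.
  destruct dichotomy_projection as (P & hP). exists P.
  assert (hPu : forall n (v p : X), stable n p -> unstable n (minus v p) -> P n v = p).
  { intros n v p h1 h2. now apply (splitting_unique n v); try apply hP. }
  assert (hker : forall n v, ker (P n) v <-> unstable n v).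
  { intros n v. unfold ker. split.
    - intros h. rewrite <- (minus_zero v), <- h. apply hP.
    - intros h. apply hPu; [apply stable_zero | now rewrite minus_zero]. }
  pose proof split_bound_pos as hsb.
  split; [|split; [|split]].
  - intros n. split; [split|].
    + intros u v. apply hPu; [apply stable_plus; apply hP|].
      rewrite minus_plus_plus. apply unstable_plus; apply hP.
    + intros a v. apply hPu; [apply stable_scal; apply hP|].
      rewrite <- minus_scal. apply unstable_scal, hP.
    + destruct (N_equiv n) as (c & c1 & hc & hc1 & h).
      exists (split_bound * c1 / c).
      split; [apply Rdiv_lt_0_compat; [now apply Rmult_lt_0_compat | exact hc]|].
      intros v. pose proof (proj1 (h (P n v))) as h3. pose proof (proj2 (h v)) as h4.
      destruct (hP n v) as (_ & _ & h5 & _).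
      apply Rmult_le_reg_l with c; [exact hc|].
      replace (c * (split_bound * c1 / c * norm v)) with (split_bound * (c1 * norm v))
        by (field; lra).
      apply Rle_trans with (split_bound * N n v); [lra|].
      apply Rmult_le_compat_l; lra.
    + intros v. apply hPu; [apply hP | rewrite minus_self; apply unstable_zero].
  - intros m. apply unstable_isomorphism; intros v; apply hker.
  - intros m n v hm. apply hPu; [apply stable_forward; [exact hm | apply hP]|].
    rewrite <- cocycle_minus by assumption. apply unstable_forward; [exact hm | apply hP].
  - destruct exponential_bounds as (omega & D & homega & hD & hs & hu).
    exists omega, (D * split_bound).
    split; [exact homega|]. split; [now apply Rmult_lt_0_compat|].
    assert (hr : forall i j a b, a <= split_bound * b ->
      D * Rpower (mu i / mu j) (- omega) * a
        <= D * split_bound * Rpower (mu i / mu j) (- omega) * b).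
    { intros i j a b hab. pose proof (exp_pos (- omega * ln (mu i / mu j))) as hexp.
      fold (Rpower (mu i / mu j) (- omega)) in hexp.
      replace (D * split_bound * Rpower (mu i / mu j) (- omega) * b)
        with (D * Rpower (mu i / mu j) (- omega) * (split_bound * b)) by ring.
      apply Rmult_le_compat_l; [|exact hab]. left. now apply Rmult_lt_0_compat. }
    split.
    + intros m n v hm. eapply Rle_trans; [apply hs; [exact hm | apply hP]|].
      apply hr, hP.
    + intros m n v z hm (hz & hzq). apply hker in hz. destruct hz as (z0 & hz0 & ->).
      eapply Rle_trans; [apply (hu m n); assumption|]. apply hr.
      rewrite cocycle_comp in hzq by lia. rewrite hzq. apply (hP n v).
Qed.

End Dichotomy.

(** * The dichotomy theorem *)

Theorem theorem3p4 (k : field_kind) (X : CompleteNormedModule (scalars k))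
  (mu : nat -> R) (A : nat -> X -> X) (N : nat -> X -> R)
  (hmu : growth_rate mu)
  (hA : forall n, is_linear (A n))
  (hN : forall n, is_norm (N n) /\ equivalent_to_norm (N n))
  (hq : exists (q : nat -> nat) (L1 L2 : R),
      (forall i j, (i <= j)%nat -> (q i <= q j)%nat) /\
      (forall n, (n + 1 <= q n)%nat) /\
      1 < L1 /\ 1 < L2 /\
      (forall n, L1 <= mu (q n) / mu n /\ mu (q n) / mu n <= L2))
  (hT : exists Z : X -> Prop,
      is_subspace Z /\ closed Z /\ T_invertible mu A N Z)
  (hgrowth : exists lambda M : R, 0 < lambda /\ 0 < M /\
      forall m n x, (n <= m)%nat ->
        N m (cocycle A m n x) <= M * Rpower (mu m / mu n) lambda * N n x) :
  mu_dichotomy mu A N.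
Proof.
  destruct hq as (q & L1 & L2 & _ & hq1 & hL1 & hL2 & hq2).
  destruct hT as (Z & hZ & _ & hZT).
  destruct hgrowth as (lambda & M & hlam & hM & hgr).
  destruct (admissible_of_T_invertible mu A N Z hmu (fun n => proj1 (hN n)) hZT)
    as (C & hC & hadm).
  assert (hpos : forall n, 0 < mu n) by apply hmu.
  assert (hq3 : forall n, mu (q n) <= L2 * mu n).
  { intros n. pose proof (proj2 (hq2 n)) as h. pose proof (hpos n).
    replace (mu (q n)) with (mu (q n) / mu n * mu n) by (field; lra).
    apply Rmult_le_compat_r; lra. }
  assert (hjump : forall n, mu (S n) <= L2 * mu n).
  { intros n. eapply Rle_trans; [|apply hq3].
    apply growth_rate_mono; [exact hmu|]. specialize (hq1 n). lia. }
  apply (mu_dichotomy_of_admissible mu A N Z hmu hA (fun n => proj1 (hN n)) hZ C hC hadm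
    (ln L1) (M * Rpower (L2 * L2) lambda)) with (L := L2); try assumption.
  - rewrite <- ln_1. apply ln_increasing; lra.
  - apply Rmult_lt_0_compat; [exact hM | apply exp_pos].
  - intros n. pose proof (hq1 (S n)) as h.
    (* the clock lags by one index, so the window from S n to q (S n) of mu
       becomes the window from n to q (S n) - 1 of the clock *)
    exists (q (S n) - 1)%nat. split; [lia|]. split.
    + eapply Rle_trans; [|apply (ln_le_log_clock mu hmu); lia].
      replace (S (q (S n) - 1)) with (q (S n)) by lia.
      rewrite <- ln_div by apply hpos. apply ln_le; [lra | apply hq2].
    + intros m v hm. eapply Rle_trans; [apply hgr; lia|].
      apply Rmult_le_compat_r; [apply hN|]. apply Rmult_le_compat_l; [lra|].
      apply Rle_Rpower_l; [lra|]. split; [now apply Rdiv_lt_0_compat|].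
      pose proof (hpos n).
      apply Rmult_le_reg_r with (mu n); [assumption|].
      unfold Rdiv. rewrite Rmult_assoc, Rinv_l, Rmult_1_r by lra.
      apply Rle_trans with (mu (q (S n))); [apply growth_rate_mono; [exact hmu | lia]|].
      eapply Rle_trans; [apply hq3|]. rewrite Rmult_assoc.
      apply Rmult_le_compat_l; [lra | apply hjump].
  - intros n. apply hN.
Qed.
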